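(* Let $k \geq 2$ be an integer and let $D$ be a digraph of order $n \geq k+1$. If $\delta^{0}(D) \geq \lceil (n+k-1)/2 \rceil$, then $D$ is one-to-one $k$-coverable. Moreover, the bound for $\delta^{0}(D)$ is sharp when $n+k$ is odd and is sharp up to an additive constant $1$ otherwise, in the following sense: for every $k\geq 2$ and every $n\geq k+1$, if $n+k$ is odd there exists a digraph $D$ on $n$ vertices with $\delta^{0}(D)=\lceil (n+k-1)/2\rceil-1$ which is not one-to-one $k$-coverable, and if $n+k$ is even there exists a digraph $D$ on $n$ vertices with $\delta^{0}(D)=\lceil (n+k-1)/2\rceil-2$ which is not one-to-one $k$-coverable.
   Context: All digraphs $D=(V(D),A(D))$ are finite, with no parallel arcs and no loops (pairs of oppositely directed arcs are allowed). The order of $D$ is $|V(D)|$. A path always means a directed path; an $x$-$y$ path is a path from $x$ to $y$. The minimum semi-degree $\delta^{0}(D)$ is the minimum, over all vertices $v$ of $D$, of the out-degrees $d^{+}_D(v)$ and in-degrees $d^{-}_D(v)$. Let $S=\{s\}$ (source set) and $T=\{t\}$ (sink set) with $s\neq t$ vertices of $D$. A one-to-one $k$-DDPC ($k$-disjoint directed path cover) for $S$ and $T$ is a set of $k$ (distinct) paths $\{P_1,\dots,P_k\}$ of $D$ such that $\bigcup_{i=1}^{k}V(P_i)=V(D)$, each $P_i$ is an $s$-$t$ path, and $V(P_i)\cap V(P_j)=\{s,t\}$ for $i\neq j$. A digraph $D$ of order $n\geq k+1$ is one-to-one $k$-coverable if it has a one-to-one $k$-DDPC for every pair of disjoint source set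 $S=\{s\}$ and sink set $T=\{t\}$. *)

(* Defs.v *)
From mathcomp Require Import all_boot.

Set Implicit Arguments.
Unset Strict Implicit.
Unset Printing Implicit Defensive.

Record digraph := Digraph {
  vertex :> finType;
  arc : rel vertex;
  arc_irrefl : irreflexive arc
}.

Definition outdeg (D : digraph) (v : D) : nat := #|[set w : D | arc v w]|.

Definition indeg (D : digraph) (v : D) : nat := #|[set w : D | arc w v]|.

(* Every degree is less than #|D|, so for a nonempty D the default value #|D|
   of the iterated minimum is neutral. *)
Definition min_semidegree (D : digraph) : nat :=
  \big[minn/#|D|]_(v : D) minn (outdeg v) (indeg v).

(* A path is given by the list of all its vertices, both ends included; as
   there are no parallel arcs, this list determines the path. *)
Definition is_path (D : digraph) (x y : D) (p : seq D) : Prop :=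
  exists q : seq D,
    [/\ p = x :: q, path (@arc D) x q, last x q = y & uniq p].

(* Injectivity says that the k paths are distinct; the intersection condition
   alone would allow the path consisting of the arc (s, t) to be repeated. *)
Definition is_DDPC (k : nat) (D : digraph) (s t : D) (P : 'I_k -> seq D)
    : Prop :=
  [/\ injective P,
      \bigcup_(i < k) [set x in P i] = [set: D],
      forall i, is_path s t (P i)
    & forall i j, i != j ->
        [set x in P i] :&: [set x in P j] = [set s; t]].

Definition one_to_one_coverable (k : nat) (D : digraph) : Prop :=
  forall s t : D, s != t -> exists P : 'I_k -> seq D, is_DDPC s t P.

(* Main.v *)
From mathcomp Require Import all_boot zify.
Require Import Defs.

Set Implicit Arguments.
Unset Strict Implicit.
Unset Printing Implicit Defensive.

(** Sufficiency.  Fix s and t and write n for the order of D.  The degree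
    condition makes D have a Hamiltonian s-t path: identify t with s, letting
    the merged vertex keep the out-arcs of s and the in-arcs of t; every
    semi-degree drops by at most one, so the resulting digraph of order n - 1
    satisfies the condition of Ghouila-Houri's theorem ([ghouila_houri]), and
    a Hamiltonian cycle through the merged vertex is a Hamiltonian s-t path of
    D ([hamiltonian_path]).

    Such a path can be cut between consecutive inner vertices y and z as soon
    as y -> t and s -> z are arcs: the part up to y is completed by t, and the
    part from z on is started by s.  Let d be the minimum semi-degree, and let a
    be 1 or 0 according to whether s -> t is an arc.  There are n - 3
    consecutive pairs.  At least d - a - 1 of them have an in-neighbour of t as
    y and at least d - a - 1 have an out-neighbour of s as z, since only the
    last, respectively first, inner vertex of the path is lost in the count.
    As 2d >= n + k - 1, pigeonhole gives at least k - 1 - a good cuts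
    ([cut_seq]), hence k - a disjoint pieces that cover the inner vertices; when
    a = 1 the arc s -> t is the last path ([coverable_of_semidegree]).

    Ghouila-Houri's theorem is proved by an insertion argument.  Let C be a
    longest cycle and suppose that it misses a vertex.  It contains more than
    half of the vertices ([cycle_longer_than_outdegrees]).  Take a maximal path
    u ... v outside C, with r < |C| vertices.  All but at most r - 1 of the
    in-neighbours of u and of the out-neighbours of v lie on C.  If x is an
    in-neighbour of u on C, then none of the r vertices that follow x on C is an
    out-neighbour of v, for otherwise the detour through u ... v would give a
    longer cycle.  Counting the in-neighbours of u and the out-neighbours of v
    along C then contradicts the degree condition; the same pigeonhole principle
    [cut_seq] does the counting.

    Sharpness.  Glue two complete digraphs along k - 1 common vertices and put
    s and t on different sides.  Every s-t path uses a common vertex, and k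
    internally disjoint ones cannot.  Sizes of the two sides that differ by at
    most one make the minimum semi-degree as large as claimed
    ([min_semidegree_glued_cliques], [glued_cliques_not_coverable]). *)

(** * Longest sequences, paths and cycles *)

Lemma longest_seq (T : finType) (P : pred (seq T)) (s0 : seq T) :
    P s0 -> (forall s, P s -> uniq s) ->
  exists2 s, P s & forall s', P s' -> size s' <= size s.
Proof.
move=> Ps0 Puniq.
pose realized n := [exists u : n.-tuple T, P u].
have realizedP s : P s -> realized (size s).
  by move=> Ps; apply/existsP; exists (in_tuple s).
have bounded n : realized n -> n <= #|T|.
  case/existsP=> u /Puniq/card_uniqP card_u.
  by rewrite -(size_tuple u) -card_u max_card.
case: (ex_maxnP (ex_intro realized _ (realizedP _ Ps0)) bounded).
move=> n /existsP[u Pu] max_n.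
by exists u => // s' /realizedP/max_n; rewrite size_tuple.
Qed.

(** A path of X with the largest number of vertices cannot be extended at
    either end, so all neighbours of its ends that lie in X are on the path. *)
Lemma maximal_path (T : finType) (e : rel T) (X : {set T}) (x0 : T) :
    x0 \in X ->
  exists x p, [/\ path e x p, uniq (x :: p), {subset x :: p <= X},
    forall y, y \in X -> e y x -> y \in x :: p
  & forall y, y \in X -> e (last x p) y -> y \in x :: p].
Proof.
move=> Xx0; pose P s := [&& sorted e s, uniq s & all [in X] s].
have P0 : P [:: x0] by rewrite /P /= Xx0.
have Puniq s : P s -> uniq s by case/and3P.
have [[|x p] Pxp max_p] := longest_seq P0 Puniq; first by have := max_p _ P0.
have /and3P[e_p uniq_p X_p] := Pxp.
exists x, p; split=> // [|y Xy e_y|y Xy e_y]; first exact/allP.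
  apply/negPn/negP => p'y; have /max_p : P (y :: x :: p).
    by apply/and3P; split; [rewrite /= e_y | rewrite cons_uniq p'y | apply/andP].
  by rewrite /= ltnn.
apply/negPn/negP => p'y; have /max_p : P (rcons (x :: p) y).
  apply/and3P; split; last by rewrite all_rcons; apply/andP.
    by rewrite /= rcons_path e_y andbT.
  by rewrite rcons_uniq p'y.
by rewrite size_rcons ltnn.
Qed.

(** All out-neighbours of the last vertex of a maximal path are on the path, and
    the arc to the first of them closes a cycle containing all of them and the
    last vertex itself. *)
Lemma cycle_longer_than_outdegrees (T : finType) (e : rel T) (x0 : T) (d : nat) :
    irreflexive e -> 0 < d -> (forall x, d <= #|[set y | e x y]|) ->
  exists2 c, cycle e c && uniq c & d < size c.
Proof.
move=> e_irr d_gt0 deg_e.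
have [x [p [e_p uniq_p _ _ end_p]]] := maximal_path e (in_setT x0).
set v := last x p in end_p.
have [y0 vy0] : exists y, e v y.
  have /card_gt0P[y] := leq_trans d_gt0 (deg_e v).
  by rewrite inE; exists y.
have [y [p1 [p2 [vy p1'v def_p]]]] :
    exists y p1 p2, [/\ e v y, ~~ has (e v) p1 & x :: p = p1 ++ y :: p2].
  have : has (e v) (x :: p) by apply/hasP; exists y0; first exact: end_p.
  by case/split_find=> y p1 p2 vy p1'v; exists y, p1, p2; rewrite cat_rcons.
have last_p2 : last y p2 = v by rewrite /v -[LHS](last_cat x p1 (y :: p2)) -def_p.
have : sorted e (p1 ++ y :: p2) by rewrite -def_p.
move: uniq_p; rewrite def_p cat_uniq => /and3P[_ _ uniq_p2] /cat_sorted2[_ e_p2].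
exists (y :: p2).
  by rewrite uniq_p2 /= rcons_path last_p2 vy !andbT.
rewrite (leq_ltn_trans (deg_e v)) // -(card_uniqP uniq_p2); apply: proper_card.
apply/properP; split.
  apply/subsetP=> z; rewrite inE => vz.
  have : z \in p1 ++ y :: p2 by rewrite -def_p end_p.
  by rewrite mem_cat => /orP[/(hasPn p1'v)/negP|].
by exists v; [rewrite -last_p2 mem_last | rewrite inE e_irr].
Qed.

(** * Cutting a sequence at good consecutive pairs *)

(** A pair of consecutive entries (y, z) with P y and Q z is a place to cut.
    There are [size q] consecutive pairs in x :: q; [belast x q] lists their
    first components and [q] their second ones, so if P and Q hold at least
    [j + size q] times in total, then at least j pairs satisfy both. *)
Lemma cut_seq (T : eqType) (P Q : pred T) (x : T) (q : seq T) (j : nat) :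
    P (last x q) -> j + size q <= count P (belast x q) + count Q q ->
  exists r ss, [/\ x :: q = (x :: r) ++ flatten ss, size ss = j, P (last x r)
    & all (fun c => if c is y :: c' then Q y && P (last y c') else false) ss].
Proof.
elim: q x j => [|y q IHq] x [|j] //=.
- by move=> Px _; exists [::], [::].
- by move=> Px _; exists (y :: q), [::]; rewrite /= cats0.
move=> Plast le_j.
have [/andP[Px Qy]|PQ'xy] := boolP (P x && Q y).
  have [|r [ss [-> <- Pr good_ss]]] := IHq y j Plast; first by lia.
  by exists [::], ((y :: r) :: ss); rewrite /= Px Qy Pr.
have [|r [ss [-> <- Pr good_ss]]] := IHq y j.+1 Plast.
  by move: PQ'xy le_j; case: (P x); case: (Q y); lia.
by exists (y :: r), ss.
Qed.

Lemma last_hit (T : Type) (P : pred T) (x : T) (s : seq T) :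
    has P (x :: s) ->
  exists w g, [/\ s = w ++ g, P (last x w) & ~~ has P g].
Proof.
elim: s x => [|y s IHs] x; first by rewrite /= orbF; exists [::], [::].
have [/IHs[w [g [-> Pw Pg]]] _|Pys] := boolP (has P (y :: s)).
  by exists (y :: w), g.
by rewrite [has _ _]/= -/(has P (y :: s)) (negPf Pys) orbF; exists [::], (y :: s).
Qed.

(** * Ghouila-Houri's theorem *)

Lemma ghouila_houri (T : finType) (e : rel T) (d : nat) :
    irreflexive e -> #|T| <= d.*2 ->
    (forall x, d <= #|[set y | e x y]|) -> (forall x, d <= #|[set y | e y x]|) ->
  exists c, [/\ cycle e c, uniq c & forall x, x \in c].
Proof.
move=> e_irr le_T_d outdeg_e indeg_e.
pose P c := cycle e c && uniq c.
have Puniq c : P c -> uniq c by case/andP.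
have [c Pc max_c] := longest_seq (isT : P [::]) Puniq.
have [e_c uniq_c] := andP Pc.
exists c; split=> //; have [/forallP//|] := boolP [forall x, x \in c].
rewrite negb_forall => /existsP[x0 c'x0]; exfalso.
have d_gt0 : 0 < d.
  by rewrite -double_gt0 (leq_trans _ le_T_d) //; apply/card_gt0P; exists x0.
have lt_d_c : d < size c.
  have [c0 Pc0 lt_d] := cycle_longer_than_outdegrees x0 e_irr d_gt0 outdeg_e.
  exact: leq_trans lt_d (max_c _ Pc0).
have X_x0 : x0 \in ~: [set x in c] by rewrite !inE.
have [u [p [e_p uniq_p sub_p in_u out_v]]] := maximal_path e X_x0.
set v := last u p in out_v.
have le_pc : (size p).+1 + size c <= #|T|.
  suff /card_uniqP : uniq (c ++ u :: p).
    by rewrite size_cat addnC => <-; apply: max_card.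
  rewrite cat_uniq uniq_c uniq_p andbT; apply/hasPn=> y /sub_p.
  by rewrite !inE.
pose A := e^~ u; pose B := e v.
(* By maximality, the in-neighbours of u outside the cycle are on the path. *)
have leA : d <= count A c + size p.
  rewrite (leq_trans (indeg_e u)) // -size_filter -size_cat.
  apply: leq_trans (card_size _); apply/subset_leq_card/subsetP=> y.
  rewrite inE mem_cat mem_filter => yu; rewrite [A y]yu.
  have [//|c'y] := boolP (y \in c); have := in_u y; rewrite !inE c'y => /(_ isT yu).
  by case: eqP yu => // ->; rewrite e_irr.
have leB : d <= count B c + size p.
  rewrite (leq_trans (outdeg_e v)) // -(size_belast u) -size_filter -size_cat.
  apply: leq_trans (card_size _); apply/subset_leq_card/subsetP=> y.
  rewrite inE mem_cat mem_filter => vy; rewrite [B y]vy.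
  have [//|c'y] := boolP (y \in c); have := out_v y.
  rewrite in_setC in_set c'y lastI mem_rcons inE => /(_ isT vy).
  by case: eqP vy => // ->; rewrite e_irr.
have /hasP[b c_b Bb] : has B c by rewrite has_count; lia.
have [i c' def_c] := rot_to c_b.
(* Replacing the stretch g of the cycle by the path u ... v yields a cycle,
   which is not longer than the longest one. *)
have {max_c} detour j y s g : rot j (b :: c') = (y :: s) ++ g ->
    A (last y s) -> B y -> size p < size g.
  move=> def_s Ays By.
  have : P ((y :: s) ++ g) by rewrite /P -def_s -def_c !rot_cycle !rot_uniq.
  rewrite /P [cycle _ _]/= rcons_cat cat_path cat_uniq.
  case/andP=> /andP[e_s _] /andP[uniq_s _].
  have c_s z : z \in y :: s -> z \in c.
    by rewrite -(mem_rot i c) def_c -(mem_rot j (b :: c')) def_s mem_cat => ->.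
  have /max_c : P ((y :: s) ++ u :: p).
    rewrite /P [cycle _ _]/= rcons_cat cat_path e_s /= rcons_path e_p.
    rewrite (Ays : e _ u) (By : e (last u p) y).
    rewrite -[_ && _]/(uniq ((y :: s) ++ u :: p)) cat_uniq uniq_s uniq_p andbT.
    apply/hasPn=> z /sub_p.
    by rewrite !inE; apply: contraNN => /c_s.
  by rewrite -(size_rot i c) def_c -(size_rot j (b :: c')) def_s !size_cat leq_add2l.
have sz_c : size c = (size c').+1 by rewrite -(size_rot i) def_c.
have cnt_c X : count X c = count X (b :: c').
  by rewrite -def_c; apply/permP; rewrite perm_sym perm_rot.
rewrite !cnt_c in leA leB.
(* Read the cycle from b on, and let w end at the last in-neighbour of u. *)
have hasA : has A (b :: c').
  by rewrite has_count; move: le_T_d le_pc lt_d_c leA; clear; lia.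
have [w [g [def_c' Aw A'g]]] := last_hit hasA.
(* No in-neighbour of u is directly followed by an out-neighbour of v, since
   the path u ... v could be inserted between them. *)
have le_w : count A (belast b w) + count B w <= size w.
  rewrite leqNgt; apply/negP=> /(@cut_seq _ A B b w 1 Aw)[r [ss [def_w]]].
  case: ss def_w => [|[|z r'] [|? ?]] //=; rewrite cats0 => -[def_w] _ Ar.
  rewrite !andbT => /andP[Bz _].
  have := detour (size (b :: r)) z (r' ++ g ++ b :: r) [::].
  rewrite cats0 def_c' def_w -catA -[b :: r ++ _]/((b :: r) ++ (z :: r') ++ g).
  rewrite rot_size_cat.
  by rewrite !last_cat -catA => /(_ erefl Ar Bz).
(* The first [size p + 1] vertices after the last in-neighbour of u are not
   out-neighbours of v: a detour to one of them would skip at most [size p]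
   vertices of the cycle and gain the [size p + 1] vertices of u ... v. *)
have le_g : count B g + size p < size g.
  (* The detour may skip all of g, because b is an out-neighbour of v. *)
  have le_pg : size p < size g by apply: (detour 0 b w) => //; rewrite rot0 def_c'.
  have B'g : count B (take (size p).+1 g) = 0.
    apply/eqP; rewrite -leqn0 leqNgt -has_count; apply/negP=> hasB.
    have [z [g1 [g2 [Bz def_g le_g1]]]] : exists z g1 g2,
        [/\ B z, g = g1 ++ z :: g2 & size g1 <= size p].
      have def_g := cat_take_drop (size p).+1 g.
      have := size_takel le_pg; move: hasB def_g.
      case/split_find=> z g1 g2 Bz _ <-; rewrite cat_rcons -catA => sz_g.
      exists z, g1, (g2 ++ drop (size p).+1 g); split=> //.
      by rewrite -ltnS -sz_g size_cat /= addnS ltnS leq_addr.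
    have := detour (size ((b :: w) ++ g1)) z (g2 ++ b :: w) g1.
    rewrite def_c' def_g -cat_cons catA rot_size_cat !last_cat.
    rewrite -[z :: g2 ++ b :: w]cat_cons -catA => /(_ erefl Aw Bz).
    by rewrite ltnNge le_g1.
  have -> : count B g = count B (drop (size p).+1 g).
    by rewrite -[in LHS](cat_take_drop (size p).+1 g) count_cat B'g.
  by rewrite -addnS addnC -leq_subRL // -size_drop count_size.
have cntA : count A (b :: c') = (count A (belast b w)).+1.
  rewrite def_c' -cat_cons count_cat lastI -cats1 count_cat /= Aw.
  by move: A'g; rewrite has_count -eqn0Ngt => /eqP->; rewrite addn0 addn1.
have cntB : count B (b :: c') = (count B w + count B g).+1.
  by rewrite def_c' /= count_cat Bb.
move: le_T_d le_pc leA leB le_w le_g.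
rewrite -addnn sz_c def_c' size_cat -def_c' cntA cntB.
move: #|T| (size p) (size w) (size g) (count A _) (count B w) (count B g).
by clear; lia.
Qed.

(** * Hamiltonian paths with prescribed ends *)

(** Merging t into s turns Hamiltonian s-t paths into Hamiltonian cycles, on one
    vertex fewer and with semi-degrees lowered by at most one.  The arc from s
    to t, if there is one, becomes a loop and is dropped. *)
Lemma hamiltonian_path (D : digraph) (s t : D) (d : nat) :
    s != t -> #|D| < d.*2 ->
    (forall v : D, d <= outdeg v) -> (forall v : D, d <= indeg v) ->
  exists q, [/\ path (@arc D) s (rcons q t), uniq q
              & forall v, (v \in q) = (v != s) && (v != t)].
Proof.
move=> s't lt_D_d out_d in_d.
pose V : finType := {v : D | v != t}; pose s1 : V := Sub s s't.
(* An arc of the merged digraph that ends in s stands for an arc of D into t. *)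
pose tl (v : V) : D := if v == s1 then t else val v.
pose e (u v : V) := (u != v) && arc (val u) (tl v).
have e_irr : irreflexive e by move=> u; rewrite /e eqxx.
have card_V : #|V| <= d.-1.*2.
  rewrite card_sig.
  have -> : #|[pred x : D | x != t]| = #|D|.-1.
    by rewrite -(cardC1 t); apply: eq_card.
  by lia.
(* The at most one out-neighbour x of u that is lost is t if u is the merged
   vertex, and s otherwise. *)
have out_e u : d.-1 <= #|[set v | e u v]|.
  pose x := if u == s1 then t else s.
  have : [set w | arc (val u) w] :\ x \subset tl @: [set v | e u v].
    apply/subsetP=> w; rewrite !inE => /andP[x'w uw].
    have [eq_wt|t'w] := eqVneq w t.
      have s1'u : u != s1 by apply: contraNneq x'w => eq_u; rewrite /x eq_u eqxx eq_wt.
      apply/imsetP; exists s1; last by rewrite /tl eqxx.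
      by move: uw; rewrite inE /e s1'u /tl eqxx eq_wt.
    have s1'w : (Sub w t'w : V) != s1.
      rewrite -val_eqE /=; apply: contraNneq x'w => eq_ws; rewrite /x eq_ws.
      by case: (eqVneq u s1) uw => // ->; rewrite eq_ws arc_irrefl.
    apply/imsetP; exists (Sub w t'w); last by rewrite /tl (negPf s1'w).
    rewrite inE /e /tl (negPf s1'w) uw andbT -val_eqE /=.
    by apply: contraTneq uw => <-; rewrite arc_irrefl.
  move/subset_leq_card/leq_trans/(_ (leq_imset_card _ _)); apply: leq_trans.
  have := out_d (val u); rewrite /outdeg (cardsD1 x); lia.
have in_e v : d.-1 <= #|[set u | e u v]|.
  pose x := if v == s1 then s else t.
  have : [set w | arc w (tl v)] :\ x \subset val @: [set u | e u v].
    apply/subsetP=> w; rewrite !inE => /andP[x'w wv].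
    have t'w : w != t.
      move: x'w wv; rewrite /x /tl; case: (eqVneq v s1) => // _ _ wt.
      by apply: contraTneq wt => ->; rewrite arc_irrefl.
    apply/imsetP; exists (Sub w t'w) => //; rewrite inE /e wv andbT.
    move: x'w wv; rewrite /x /tl; case: (eqVneq v s1) => [->|_ _ wv].
      by rewrite -val_eqE.
    by rewrite -val_eqE; apply: contraTneq wv => /= ->; rewrite arc_irrefl.
  move/subset_leq_card/leq_trans/(_ (leq_imset_card _ _)); apply: leq_trans.
  have := in_d (tl v); rewrite /indeg (cardsD1 x); lia.
have [c [e_c uniq_c full_c]] := ghouila_houri e_irr card_V out_e in_e.
have [i q def_c] := rot_to (full_c s1).
move: e_c uniq_c; rewrite -(rot_cycle i) -(rot_uniq i) def_c /=.
move=> e_q /andP[s'q uniq_q].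
exists (map val q); split; last first.
- move=> v; have [->|t'v] := eqVneq v t.
    rewrite andbF; apply/negP=> /mapP[u _ eq_tu].
    by have := valP u; rewrite -eq_tu eqxx.
  have := full_c (Sub v t'v); rewrite -(mem_rot i) def_c inE -val_eqE /= andbT.
  rewrite -(mem_map val_inj); case: eqVneq => //= -> _.
  by apply/negbTE; rewrite -[s]/(val s1) (mem_map val_inj).
- by rewrite (map_inj_uniq val_inj).
have: forall x p, s1 \notin p -> path e x (rcons p s1) ->
    path (@arc D) (val x) (rcons (map val p) t).
  move=> x p; elim: p x => [|y p IHp] x.
    by rewrite /= /e /tl eqxx => _ /andP[/andP[_ ->]].
  rewrite inE negb_or /= => /andP[s1'y s1'p] /andP[/andP[_ xy] /(IHp _ s1'p)->].
  by move: xy; rewrite /tl eq_sym (negPf s1'y) => ->.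
by move/(_ s1 q s'q e_q).
Qed.

(** * Disjoint path covers from pieces of a Hamiltonian path *)

Lemma disjoint_pieces (T : eqType) (ss : seq (seq T)) (i j : nat) (v : T) :
    uniq (flatten ss) -> v \in nth [::] ss i -> v \in nth [::] ss j -> i = j.
Proof.
have mem_flat ss' n : v \in nth [::] ss' n -> v \in flatten ss'.
  have [lt_n v_n|le_n] := ltnP n (size ss'); last by rewrite nth_default.
  by apply/flattenP; exists (nth [::] ss' n); first exact: mem_nth.
elim: ss i j => [|c ss IHss] [|i] [|j] //=; rewrite cat_uniq => /and3P[_ disj uniq_ss].
- by move=> vc /mem_flat/(hasPn disj); rewrite vc.
- by move=> /mem_flat/(hasPn disj) /negP.
by move=> vi vj; congr _.+1; exact: IHss vi vj.
Qed.

Lemma uniq_pieces (T : eqType) (ss : seq (seq T)) :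
  uniq (flatten ss) -> [::] \notin ss -> uniq ss.
Proof.
move=> uniq_ss ss'0; apply/(uniqP [::])=> i j lt_i _ eq_ij.
have := mem_nth [::] lt_i; case def_i: (nth [::] ss i) => [|v c].
  by rewrite (negPf ss'0).
by move=> _; apply: (@disjoint_pieces _ ss i j v); rewrite -?eq_ij ?def_i ?mem_head.
Qed.

(** A disjoint path cover is determined by the inner parts of its paths.  Only
    one of them may be empty, which is what [uniq ss] adds to the disjointness
    expressed by [uniq (flatten ss)]. *)
Lemma DDPC_of_pieces (k : nat) (D : digraph) (s t : D) (ss : seq (seq D)) :
    0 < k -> s != t -> size ss = k -> uniq ss -> uniq (flatten ss) ->
    (forall v, (v \in flatten ss) = (v != s) && (v != t)) ->
    (forall c, c \in ss -> path (@arc D) s (rcons c t)) ->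
  exists P : 'I_k -> seq D, is_DDPC s t P.
Proof.
move=> k_gt0 s't sz_ss uniq_ss uniq_fl fl_ss path_ss.
pose piece (i : 'I_k) := nth [::] ss i.
have ss_piece i : piece i \in ss by rewrite mem_nth // sz_ss.
have piece_inner i v : v \in piece i -> (v != s) && (v != t).
  by move=> vi; rewrite -fl_ss; apply/flattenP; exists (piece i).
exists (fun i => s :: rcons (piece i) t); split.
- move=> i j [eq_rcons]; have eq_ij := rcons_injl _ eq_rcons; apply/val_inj/eqP.
  by rewrite -(nth_uniq [::] _ _ uniq_ss) ?sz_ss ?ltn_ord //; apply/eqP.
- apply/setP=> v; rewrite in_setT; apply/bigcupP.
  have [/flattenP[c ss_c cv]|] := boolP (v \in flatten ss).
    have lt_ic : index c ss < k by rewrite -sz_ss index_mem.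
    exists (Ordinal lt_ic) => //.
    by rewrite !inE mem_rcons inE /piece /= nth_index // cv !orbT.
  rewrite fl_ss negb_and !negbK => v_st; exists (Ordinal k_gt0) => //.
  by rewrite !inE mem_rcons inE; case/orP: v_st => ->; rewrite ?orbT.
- move=> i; exists (rcons (piece i) t); split=> //; first exact/path_ss.
    exact: last_rcons.
  have uniq_i : uniq (piece i).
    move: uniq_fl; case/splitPr: (ss_piece i) => ss1 ss2.
    by rewrite flatten_cat cat_uniq /= cat_uniq => /and4P[_ _ ->].
  have s'i : s \notin piece i by apply/negP=> /piece_inner; rewrite eqxx.
  have t'i : t \notin piece i by apply/negP=> /piece_inner; rewrite eqxx andbF.
  by rewrite /= mem_rcons inE negb_or s't s'i rcons_uniq t'i.
move=> i j i'j; apply/setP=> v; rewrite !inE !mem_rcons !inE.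
have [//|s'v] := eqVneq v s; have [//|t'v] := eqVneq v t; rewrite /=.
apply/negP=> /andP[vi vj]; case/eqP: i'j; apply: val_inj.
exact: disjoint_pieces vi vj.
Qed.

(** * The degree condition suffices *)

Lemma min_semidegree_le (D : digraph) (v : D) :
  min_semidegree D <= minn (outdeg v) (indeg v).
Proof.
rewrite /min_semidegree; have: v \in index_enum D by exact: mem_index_enum.
elim: (index_enum D) => //= w r IHr; rewrite inE big_cons geq_min.
by case/predU1P=> [-> | /IHr->]; rewrite ?leqnn ?orbT.
Qed.

(** The pieces of a Hamiltonian s-t path, cut where both the arc into t and the
    arc from s exist, are the inner parts of the paths.  If s -> t is an arc,
    one cut fewer is needed: the empty piece stands for the path formed by this
    arc. *)
Lemma coverable_of_semidegree (k : nat) (D : digraph) :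
    2 <= k -> k < #|D| -> #|D| + k - 1 <= (min_semidegree D).*2 ->
  one_to_one_coverable k D.
Proof.
move=> k_ge2 lt_k_D; set d := min_semidegree D => le_d s t s't.
have out_d v : d <= outdeg v := leq_trans (min_semidegree_le v) (geq_minl _ _).
have in_d v : d <= indeg v := leq_trans (min_semidegree_le v) (geq_minr _ _).
have [|q [path_q uniq_q mem_q]] := hamiltonian_path s't _ out_d in_d; first by lia.
have sz_q : (size q).+2 = #|D|.
  have /card_uniqP : uniq (s :: t :: q).
    by rewrite /= !inE negb_or !mem_q !eqxx andbF s't.
  move=> /= <-; apply: eq_card => v; rewrite !inE mem_q.
  by case: eqP => //; case: eqP.
pose P v := arc v t; pose Q v := arc s v.
have cntP : d <= count P q + arc s t.
  rewrite (leq_trans (in_d t)) // -size_filter -(size_nseq (arc s t) s) -size_cat.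
  apply: leq_trans (card_size _); apply/subset_leq_card/subsetP=> w.
  rewrite inE mem_cat mem_filter mem_nseq mem_q => wt; rewrite [P w]wt.
  have [eq_ws|_] := eqVneq w s; first by rewrite -eq_ws wt.
  by have [eq_wt|//] := eqVneq w t; rewrite eq_wt arc_irrefl in wt.
have cntQ : d <= count Q q + arc s t.
  rewrite (leq_trans (out_d s)) // -size_filter -(size_nseq (arc s t) t) -size_cat.
  apply: leq_trans (card_size _); apply/subset_leq_card/subsetP=> w.
  rewrite inE mem_cat mem_filter mem_nseq mem_q => sw; rewrite [Q w]sw.
  have [eq_wt|_] := eqVneq w t; first by rewrite -eq_wt sw orbT.
  by have [eq_ws|//] := eqVneq w s; rewrite eq_ws arc_irrefl in sw.
case: q path_q uniq_q mem_q sz_q cntP cntQ => [|x q].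
  move=> _ _ _ /= sz_q; exfalso; move: k_ge2 lt_k_D; rewrite -sz_q.
  by clear; lia.
move=> path_q uniq_q mem_q sz_q.
have [sx path_xq Plast] : [/\ arc s x, path (@arc D) x q & P (last x q)].
  by move: path_q; rewrite /= rcons_path => /and3P[].
have -> : count P (x :: q) = (count P (belast x q)).+1.
  by rewrite lastI -cats1 count_cat /= Plast addn0 addn1.
have -> : count Q (x :: q) = (count Q q).+1 by rewrite /= [Q x]sx.
move=> cntP cntQ; pose j := k.-1 - arc s t.
have [|r [ss [def_q sz_ss Pr good_ss]]] := @cut_seq _ P Q x q j Plast.
  rewrite /= in sz_q; rewrite /j; move: le_d sz_q cntP cntQ; rewrite -addnn.
  move: #|D| (size q) (count P _) (count Q q) => nD nq nP nQ.
  by clear -k_ge2; case: (arc s t); lia.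
pose good c := if c is y :: c' then Q y && P (last y c') else false.
have good_pieces : all good ((x :: r) :: ss) by rewrite /= [Q x]sx Pr.
have fl_pieces : flatten ((x :: r) :: ss) = x :: q by rewrite def_q.
have nil_pieces : [::] \notin (x :: r) :: ss.
  by apply/negP=> /(allP good_pieces).
have path_pieces c : c \in (x :: r) :: ss -> path (@arc D) s (rcons c t).
  move=> pc; have := allP good_pieces _ pc; case: c pc => // y c pc /andP[sy yt].
  have : sorted (@arc D) (flatten ((x :: r) :: ss)) by rewrite fl_pieces.
  case/splitPr: pc => ss1 ss2; rewrite flatten_cat.
  case/cat_sorted2=> _ /cat_sorted2[c_path _].
  by rewrite /= rcons_path [arc s y]sy [arc _ t]yt andbT.
have uniq_fl : uniq (flatten ((x :: r) :: ss)) by rewrite fl_pieces.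
have uniq_p := uniq_pieces uniq_fl nil_pieces.
have eq_k : j.+1 + arc s t = k.
  by rewrite /j; case: (arc s t); move: k_ge2; clear; lia.
have k_gt0 := ltnW k_ge2.
have [st|not_st] := boolP (arc s t).
  apply: (@DDPC_of_pieces _ _ _ _ ([::] :: (x :: r) :: ss)) => //.
  - by rewrite /= sz_ss -eq_k st addn1.
  - by rewrite cons_uniq nil_pieces.
  - by move=> v; rewrite [flatten _]fl_pieces mem_q.
  by move=> c; rewrite inE => /predU1P[->|/path_pieces//]; rewrite /= st.
apply: (@DDPC_of_pieces _ _ _ _ ((x :: r) :: ss)) => //.
  by rewrite /= sz_ss -eq_k (negPf not_st) addn0.
by move=> v; rewrite fl_pieces mem_q.
Qed.

(** * Two complete digraphs glued along a separator *)

Lemma min_semidegree_eq (D : digraph) (d : nat) (v0 : D) :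
    (forall v : D, outdeg v = indeg v) -> (forall v : D, d <= outdeg v) ->
  outdeg v0 = d -> min_semidegree D = d.
Proof.
move=> deg_sym le_d deg_v0; apply/eqP; rewrite eqn_leq.
have := min_semidegree_le v0; rewrite -deg_sym minnn deg_v0 => -> /=.
apply: (big_ind (leq d)) => [|x y dx dy|v _]; last by rewrite -deg_sym minnn.
  by rewrite -deg_v0 max_card.
by rewrite leq_min dx.
Qed.

(** The two sides, of a and b vertices, and the c common vertices. *)
Definition glued_vertex (a b c : nat) : finType :=
  ('I_a + 'I_b + 'I_c)%type.

Definition glued_arc (a b c : nat) : rel (glued_vertex a b c) := fun u v =>
  (u != v) && match u, v with
              | inl (inl _), inl (inr _) | inl (inr _), inl (inl _) => false
              | _, _ => true
              end.

Lemma glued_arc_irrefl (a b c : nat) : irreflexive (@glued_arc a b c).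
Proof. by move=> u; rewrite /glued_arc eqxx. Qed.

Definition glued_cliques (a b c : nat) : digraph :=
  Digraph (@glued_arc_irrefl a b c).

Lemma card_glued_cliques (a b c : nat) : #|glued_cliques a b c| = a + b + c.
Proof. by rewrite !card_sum !card_ord. Qed.

Lemma glued_arc_sym (a b c : nat) : symmetric (@glued_arc a b c).
Proof.
by move=> u v; rewrite /glued_arc eq_sym; case: u v => [[?|?]|?] [[?|?]|?].
Qed.

Lemma outdeg_glued_cliques (a b c : nat) (v : glued_cliques a b c) :
  outdeg v = match v with
             | inl (inl _) => a.-1 + c
             | inl (inr _) => b.-1 + c
             | inr _ => a + b + c.-1
             end.
Proof.
(* [opp] is the side opposite to v: together with v itself, its vertices are the
   non-out-neighbours of v. *)
pose opp : {set glued_cliques a b c} := match v with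
  | inl (inl _) => [set inl (inr i) | i in 'I_b]
  | inl (inr _) => [set inl (inl i) | i in 'I_a]
  | inr _ => set0 end.
have out_v : [set w | arc v w] = ~: (v |: opp).
  apply/setP=> w; rewrite !inE negb_or [LHS]/= /glued_arc eq_sym; congr (_ && _).
  rewrite /opp; case: (v) w => [[i|i]|i] [[j|j]|j]; rewrite ?inE //; apply/esym;
    first [ by apply/imsetP=> [[]]
          | by apply/negbTE; rewrite negbK; apply/imsetP; exists j ].
have opp'v : v \notin opp.
  by rewrite /opp; case: (v) => [[i|i]|i]; rewrite ?inE //; apply/imsetP=> [[]].
have := cardsC (v |: opp); rewrite -out_v -/(outdeg v) cardsU1 opp'v card_glued_cliques.
have -> : #|opp| = match v with inl (inl _) => b | inl (inr _) => a | _ => 0 end.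
  rewrite /opp; case: (v) => [[i|i]|i]; rewrite ?cards0 //;
    by rewrite card_imset ?card_ord // => x y [].
by move: (outdeg v) => d; clear; case: v => [[i|i]|i]; have := ltn_ord i; lia.
Qed.

Lemma min_semidegree_glued_cliques (a b c : nat) :
  0 < a <= b -> min_semidegree (glued_cliques a b c) = a.-1 + c.
Proof.
case/andP=> a_gt0 le_ab.
pose v0 : glued_cliques a b c := inl (inl (Ordinal a_gt0)).
apply: (@min_semidegree_eq _ _ v0) => [v|v|]; last by rewrite outdeg_glued_cliques.
  by apply: eq_card => w; rewrite !inE; apply: glued_arc_sym.
rewrite outdeg_glued_cliques; case: v => [[i|i]|i] //; first by lia.
by have := ltn_ord i; lia.
Qed.

(** There is no arc between the two sides, so a path leaves the first side only
    through the common part. *)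
Lemma glued_path_meets_cut (a b c : nat) (i : 'I_a) (j : 'I_b) q :
    path (@glued_arc a b c) (inl (inl i)) q ->
    last (inl (inl i)) q = inl (inr j) ->
  exists h : 'I_c, inr h \in q.
Proof.
elim: q i => [//|[[i1|j1]|h] q IHq] i; last by exists h; rewrite mem_head.
  by case/andP=> _ /IHq{}IHq /IHq[h qh]; exists h; rewrite inE qh orbT.
by [].
Qed.

(** Each of the k paths contains a common vertex, and disjointness makes these
    distinct; but there are only c < k of them. *)
Lemma glued_cliques_not_coverable (a b c k : nat) :
  0 < a -> 0 < b -> c < k -> ~ one_to_one_coverable k (glued_cliques a b c).
Proof.
move=> a_gt0 b_gt0 lt_ck.
pose s : glued_cliques a b c := inl (inl (Ordinal a_gt0)).
pose t : glued_cliques a b c := inl (inr (Ordinal b_gt0)).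
case/(_ s t isT)=> P [_ _ path_P inter_P].
have /fin_all_exists[f Pf] : forall i, exists h : 'I_c, inr h \in P i.
  move=> i; have [q [-> q_path q_last _]] := path_P i.
  by have [h qh] := glued_path_meets_cut q_path q_last; exists h; rewrite inE qh orbT.
have inj_f : injective f.
  move=> i j eq_f; apply/eqP/negPn/negP=> /inter_P/setP/(_ (inr (f i))).
  by rewrite !inE Pf eq_f Pf.
by have := leq_card f inj_f; rewrite !card_ord leqNgt lt_ck.
Qed.

(** * The theorem *)

Theorem theorem9 (k : nat) (hk : 2 <= k) :
  (forall D : digraph,
     k + 1 <= #|D| ->
     uphalf (#|D| + k - 1) <= min_semidegree D ->
     one_to_one_coverable k D)
  /\
  (forall n : nat, k + 1 <= n ->
     (odd (n + k) ->
        exists D : digraph,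
          [/\ #|D| = n,
              min_semidegree D = uphalf (n + k - 1) - 1
            & ~ one_to_one_coverable k D])
     /\
     (~~ odd (n + k) ->
        exists D : digraph,
          [/\ #|D| = n,
              min_semidegree D = uphalf (n + k - 1) - 2
            & ~ one_to_one_coverable k D])).
Proof.
split=> [D le_kD le_d|n le_kn].
  apply: coverable_of_semidegree => //; first by rewrite -addn1.
  by move: le_d; move: #|D| (min_semidegree D) => n d; lia.
(* The sides have n - (k - 1) vertices in total, divided as equally as
   possible. *)
pose a := (n - k).+1./2; pose b := (n - k).+1 - a.
have a_gt0 : 0 < a by rewrite /a; lia.
have le_ab : a <= b by rewrite /b /a; lia.
have card_D : #|glued_cliques a b k.-1| = n.
  by rewrite card_glued_cliques /b /a; lia.
have not_cov : ~ one_to_one_coverable k (glued_cliques a b k.-1).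
  by apply: glued_cliques_not_coverable; lia.
have semideg := @min_semidegree_glued_cliques a b k.-1.
split=> parity; exists (glued_cliques a b k.-1); split=> //.
  by rewrite semideg ?a_gt0 // /a; lia.
by rewrite semideg ?a_gt0 // /a; lia.
Qed.
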